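(* Let $n\ge m\ge 3$. If $n\ge m+2\ge 5$ or $n$ is odd, then $R(\mathcal{P}^4_n,\mathcal{P}^4_m)=3n+\lfloor\frac{m+1}{2}\rfloor$.
   Context: $\mathcal{P}^4_n$ is the $4$-uniform loose path with vertex set $\{v_1,\dots,v_{3n+1}\}$ and edges $\{v_{3i-2},v_{3i-1},v_{3i},v_{3i+1}\}$, $1\le i\le n$. $R(\mathcal{G},\mathcal{H})$ is the least $N$ such that every red/blue coloring of the edges of the complete $4$-uniform hypergraph $\mathcal{K}^4_N$ contains a red copy of $\mathcal{G}$ or a blue copy of $\mathcal{H}$. *)

(* Defs.v *)
From mathcomp Require Import all_boot.
Set Implicit Arguments. Unset Strict Implicit. Unset Printing Implicit Defensive.

(* The complete 4-uniform hypergraph K^4_N has vertex set 'I_N and edge set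
   the 4-element subsets of 'I_N.  A red/blue colouring is a map
   c : {set 'I_N} -> bool (true = red, false = blue); only its values on
   4-element sets matter. *)
Definition coloring (N : nat) := {set 'I_N} -> bool.

(* A copy of the 4-uniform loose path P^4_n (vertices v_0..v_{3n}, edges
   {v_{3i},v_{3i+1},v_{3i+2},v_{3i+3}} for i < n; 0-indexed version of the
   paper's v_1..v_{3n+1}) all of whose edges satisfy [good]. *)
Definition has_loose_path4 (N n : nat) (good : {set 'I_N} -> bool) : Prop :=
  exists f : 'I_(3 * n).+1 -> 'I_N,
    injective f /\
    forall i : 'I_n, good [set f (inord (3 * i + k)) | k : 'I_4].

Definition ramsey_arrows (n m N : nat) : Prop :=
  forall c : coloring N,
    has_loose_path4 n c \/ has_loose_path4 m (fun e => ~~ c e).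

Definition ramsey_number_is (n m r : nat) : Prop :=
  ramsey_arrows n m r /\ forall N, ramsey_arrows n m N -> r <= N.

(* Main.v *)
Require Import Defs.
From mathcomp Require Import all_boot zify.

(* Lower bound: colour an edge red iff it lies inside a fixed set of 3n vertices.
   A red path is one vertex too long for that set, and each vertex outside meets
   at most two edges of a blue path.

   Upper bound: let P be a longest red path, with l edges, and W the set of
   vertices off P.  Two consecutive edges of P yield two blue edges
   {x, a1, a2, a3}, {a3, a4, a5, y} with the a_i on P and x, y in W arbitrary up
   to two exceptions each, since otherwise the two edges could be replaced by
   three red ones.  The five vertices a_i come from the six new vertices of the
   two edges and one vertex u left over from the preceding edge; they miss some
   vertex of the last edge, which is the next u (reordering an edge makes u its
   last vertex).  These pieces chain through W into a blue path zigzagging between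
   P and W, of about l edges, and an end z of P stays unused.  As P is longest,
   every {z, w, w', w''} with w, w', w'' in W is blue, which lengthens the zigzag.
   If a longest blue path has l' edges, exchanging colours gives l' <= l, whereas
   the lengthened zigzag has more than l edges or at least m. *)

(** * Loose paths as vertex sequences *)

Definition opp {T : finType} (c : {set T} -> bool) (e : {set T}) := ~~ c e.

(** The sequence lists the vertices after [x], three per edge, so any other length is rejected.
    Distinctness is left to [uniq]: paths can then be rearranged by concatenation and [perm_eq]. *)
Fixpoint lpath {T : finType} (c : {set T} -> bool) (x : T) (s : seq T) : bool :=
  match s with
  | [::] => true
  | a :: b :: d :: s' => c [set x; a; b; d] && lpath c d s'
  | _ => false
  end.

Definition has_lpath {T : finType} (c : {set T} -> bool) (l : nat) : bool :=
  [exists t : (3 * l).+1.-tuple T, uniq t && lpath c (thead t) (behead t)].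

Lemma has_lpathP {T : finType} (c : {set T} -> bool) (l : nat) :
  reflect (exists x s, [/\ lpath c x s, uniq (x :: s) & size s = 3 * l])
          (has_lpath c l).
Proof.
apply: (iffP existsP) => [[t /andP[ut pt]]|[x [s [ps us ss]]]].
  exists (thead t), (behead t); split=> //; last by rewrite size_behead size_tuple.
  by move: ut; rewrite [in uniq t](tuple_eta t).
have st : size (x :: s) == (3 * l).+1 by rewrite /= ss.
by exists (Tuple st); rewrite us.
Qed.

Lemma eq_lpath {T : finType} (c c' : {set T} -> bool) :
  c =1 c' -> lpath c =2 lpath c'.
Proof.
move=> E x s; have [n] := ubnP (size s).
elim: n x s => // n IHn x [|a [|b [|d s]]] //= sn.
by rewrite E IHn // ; lia.
Qed.

Lemma eq_has_lpath {T : finType} (c c' : {set T} -> bool) (l : nat) :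
  c =1 c' -> has_lpath c l = has_lpath c' l.
Proof. by move=> E; apply: eq_existsb => t; rewrite (eq_lpath _ _ E). Qed.

Lemma lpath_cat {T : finType} (c : {set T} -> bool) (x : T) (s1 s2 : seq T) :
  lpath c x s1 -> lpath c x (s1 ++ s2) = lpath c (last x s1) s2.
Proof.
have [n] := ubnP (size s1).
elim: n x s1 => // n IHn x [|a [|b [|d s]]] //= sn /andP[-> ps] /=.
by rewrite IHn //; lia.
Qed.

Lemma lpath_catl {T : finType} (c : {set T} -> bool) (x : T) (s1 s2 : seq T) (k : nat) :
  size s1 = 3 * k -> lpath c x (s1 ++ s2) -> lpath c x s1.
Proof.
elim: k x s1 => [|k IHk] x [|a [|b [|d s]]] //=; try lia.
by move=> sz /andP[-> ps] /=; apply: IHk ps; lia.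
Qed.

Lemma lpath_size {T : finType} (c : {set T} -> bool) (x : T) (s : seq T) :
  lpath c x s -> exists k, size s = 3 * k.
Proof.
have [n] := ubnP (size s).
elim: n x s => // n IHn x [|a [|b [|d s]]] //=; first by exists 0.
move=> sn /andP[_ /IHn[|k E]]; first by lia.
by exists k.+1; lia.
Qed.

Lemma has_lpath_widen {T : finType} (c : {set T} -> bool) (k l : nat) :
  k <= l -> has_lpath c l -> has_lpath c k.
Proof.
move=> kl /has_lpathP[x [s [ps us ss]]]; apply/has_lpathP.
exists x, (take (3 * k) s).
have st : size (take (3 * k) s) = 3 * k by rewrite size_take; case: ltnP; lia.
split=> //; first by apply: (lpath_catl c x _ (drop (3 * k) s) k st); rewrite cat_take_drop.
by rewrite -[_ :: _]/(take (3 * k).+1 (x :: s)) take_uniq.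
Qed.

Lemma max_lpath {T : finType} (c : {set T} -> bool) (n : nat) :
  0 < #|T| -> ~~ has_lpath c n ->
  exists l, [/\ l < n, has_lpath c l & ~~ has_lpath c l.+1].
Proof.
move=> T0; elim: n => [|n IHn] nn.
  case/negP: nn; apply/has_lpathP; case/card_gt0P: T0 => x _.
  by exists x, [::].
have [hn|/IHn[l [ln h1 h2]]] := boolP (has_lpath c n); first by exists n.
by exists l; split=> //; lia.
Qed.

Lemma lpath_nth {T : finType} (c : {set T} -> bool) (x y : T) (s : seq T) (n i : nat) :
  lpath c x s -> size s = 3 * n -> i < n ->
  c [set nth y (x :: s) (3 * i); nth y (x :: s) (3 * i + 1);
         nth y (x :: s) (3 * i + 2); nth y (x :: s) (3 * i + 3)].
Proof.
elim: n x s i => [|n IHn] x [|a [|b [|d s]]] i //=; try lia.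
case: i => [|i] /andP[p0 ps] sn; first by rewrite !addnE /=.
move=> i_n; have := IHn d s i ps ltac:(lia) ltac:(lia).
by rewrite (_ : 3 * i.+1 = (3 * i).+3) ?addSn; last lia.
Qed.

Lemma has_loose_of_lpath (N n : nat) (c : {set 'I_N} -> bool) :
  has_lpath c n -> has_loose_path4 n c.
Proof.
case/has_lpathP=> x [s [ps us ss]].
exists (fun j : 'I_(3 * n).+1 => nth x (x :: s) j); split.
  move=> i j /eqP; rewrite nth_uniq ?[size _]/= ?ss //; last 1 first.
  - by move/eqP/val_inj.
move=> i; have := lpath_nth c x x s n i ps ss (ltn_ord i).
congr (is_true (c _)); apply/setP=> v; apply/idP/imsetP; last first.
  case=> k _ ->; have i_n := ltn_ord i; have kn := ltn_ord k.
  rewrite inordK; last by lia.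
  case: k kn => [[|[|[|[|//]]]] kn] //= _; rewrite !inE ?addn0 eqxx ?orbT //.
rewrite !inE => /orP[/orP[/orP[|]|]|] /eqP ->.
- by exists (@Ordinal 4 0 isT) => //; rewrite inordK /= ?addn0 //; have := ltn_ord i; lia.
- by exists (@Ordinal 4 1 isT) => //; rewrite inordK /= ?addn0 //; have := ltn_ord i; lia.
- by exists (@Ordinal 4 2 isT) => //; rewrite inordK /= ?addn0 //; have := ltn_ord i; lia.
- by exists (@Ordinal 4 3 isT) => //; rewrite inordK /= ?addn0 //; have := ltn_ord i; lia.
Qed.

(** * Reorderings, red neighbourhoods, and the tent given by two edges *)

Lemma perm_set4 {T : finType} (a b d e a' b' d' e' : T) :
  perm_eq [:: a; b; d; e] [:: a'; b'; d'; e'] ->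
  [set a; b; d; e] = [set a'; b'; d'; e'].
Proof.
by move=> /perm_mem E; apply/setP=> x; have := E x; rewrite !inE !orbA.
Qed.

(** Permutations are proved by counting: for an arbitrary predicate both sides are sums of the same
    0/1 terms, which become variables of a linear problem. *)
Ltac count_arith :=
  clear; repeat match goal with |- context [nat_of_bool ?b] => move: (nat_of_bool b) => ? end;
  lia.

Ltac perm_arith := by apply/permP=> ? /=; rewrite ?count_cat /=; count_arith.

Ltac same_set4 := by apply: perm_set4; perm_arith.

(** Brings the five other orders of a triple to the order [a b d], so that a case analysis sees one
    boolean per unordered triple. *)
Ltac canon H a b d :=
  rewrite ?(H b a d a b d ltac:(perm_arith)) ?(H a d b a b d ltac:(perm_arith))
    ?(H d b a a b d ltac:(perm_arith)) ?(H b d a a b d ltac:(perm_arith))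
    ?(H d a b a b d ltac:(perm_arith)).

Definition red_nbrs {T : finType} (c : {set T} -> bool) (W : {set T}) (a b d : T) :=
  [set w in W | c [set w; a; b; d]].

Lemma perm_red_nbrs {T : finType} (c : {set T} -> bool) (W : {set T})
    (a b d a' b' d' : T) :
  perm_eq [:: a; b; d] [:: a'; b'; d'] ->
  red_nbrs c W a b d = red_nbrs c W a' b' d'.
Proof.
move=> E; apply/setP=> w; rewrite !inE; congr (_ && c _).
by apply: perm_set4; rewrite perm_cons.
Qed.

Lemma exists_notin {T : finType} (V X : {set T}) :
  #|X| < #|V| -> exists2 x, x \in V & x \notin X.
Proof.
move=> XV; have [sub|/subsetPn //] := boolP (V \subset X).
by have := subset_leq_card sub; lia.
Qed.

Lemma cards_rem1 {T : finType} (V : {set T}) (x : T) :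
  x \in V -> #|V :\ x| = #|V|.-1.
Proof. by move=> xV; rewrite [#|V|](cardsD1 x) xV. Qed.

Lemma three_reps {T : finType} (X Y Z : {set T}) :
  2 < #|X| -> 2 < #|Y| -> 2 < #|Z| ->
  exists x y z, [/\ x \in X, y \in Y, z \in Z & uniq [:: x; y; z]].
Proof.
move=> X2 Y2 Z2.
have [|x xX _] := exists_notin X set0; first by rewrite cards0; lia.
have [|y yY] := exists_notin Y [set x]; first by rewrite cards1; lia.
rewrite inE => yx.
have [|z zZ] := exists_notin Z [set x; y]; first by rewrite cards2; lia.
rewrite !inE negb_or => /andP[zx zy].
exists x, y, z; split=> //=; rewrite !inE negb_or andbT.
by rewrite ![x == _]eq_sym ![y == z]eq_sym yx zx zy.
Qed.

(* [d] = (a1, ..., a5) stands for the future pair of blue edges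
   {x, a1, a2, a3}, {a3, a4, a5, y}; at most two vertices of [W] are unusable as x,
   and at most two as y. *)
Definition tent {T : finType} (c : {set T} -> bool) (W : {set T})
    (d : T * T * T * T * T) :=
  let: (a1, a2, a3, a4, a5) := d in
  (#|red_nbrs c W a1 a2 a3| <= 2) && (#|red_nbrs c W a3 a4 a5| <= 2).

Definition tent_seq {T : finType} (d : T * T * T * T * T) :=
  let: (a1, a2, a3, a4, a5) := d in [:: a1; a2; a3; a4; a5].

(* [u] is the leftover vertex of the preceding edge (the prefix [p :: A] has been
   reordered to end in it) and [u'] is the one handed to the next window. *)
Lemma window {T : finType} (c : {set T} -> bool) (W : {set T}) (p u : T)
    (A s : seq T) (v2 v3 v4 v5 v6 v7 : T) :
  lpath c p A -> last p A = u -> lpath c v7 s ->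
  uniq (p :: A ++ [:: v2; v3; v4; v5; v6; v7] ++ s) ->
  {in W, forall w, w \notin p :: A ++ [:: v2; v3; v4; v5; v6; v7] ++ s} ->
  ~~ has_lpath c ((size A + size s) %/ 3 + 3) ->
  exists d o u', [/\ tent c W d, u' \in [:: v5; v6; v7] &
    perm_eq (tent_seq d ++ [:: o; u']) [:: u; v2; v3; v4; v5; v6; v7]].
Proof.
move=> pA lA ps us Wd nolong.
(* Three is the threshold at which any three heavy triples have distinct representatives in [W], by
   greedy choice. *)
pose heavy a b d := 2 < #|red_nbrs c W a b d|.
have heavyC a b d a' b' d' : perm_eq [:: a; b; d] [:: a'; b'; d'] ->
    heavy a b d = heavy a' b' d'.
  by rewrite /heavy => /(perm_red_nbrs c W) ->.
have nopath a x b y d :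
    perm_eq [:: a; x; b; y; d] [:: v2; v3; v4; v5; v6] ->
    ~~ [&& heavy u a x, heavy x b y & heavy y d v7].
  move=> pe; apply: contra nolong => /and3P[h1 h2 h3].
  have [w1 [w2 [w3 [W1 W2 W3 uw]]]] := three_reps _ _ _ h1 h2 h3.
  move: W1 W2 W3; rewrite !inE => /andP[W1 c1] /andP[W2 c2] /andP[W3 c3].
  (* Three heavy triples lead from [u] to [v7] by three red edges in place of two, and the remaining
     path [s] still starts at [v7]. *)
  apply/has_lpathP; exists p, (A ++ [:: a; w1; x; b; w2; y; d; w3; v7] ++ s).
  have [kA EA] := lpath_size _ _ _ pA; have [ks Es] := lpath_size _ _ _ ps.
  split; last by move: EA Es; clear; rewrite !size_cat /=; lia.
    rewrite lpath_cat // lA /= ps andbT.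
    rewrite (_ : [set u; a; w1; x] = [set w1; u; a; x]) ?c1; last same_set4.
    rewrite (_ : [set x; b; w2; y] = [set w2; x; b; y]) ?c2; last same_set4.
    by rewrite (_ : [set y; d; w3; v7] = [set w3; y; d; v7]) ?c3; last same_set4.
  have -> : uniq (p :: A ++ [:: a; w1; x; b; w2; y; d; w3; v7] ++ s) =
      uniq ([:: w1; w2; w3] ++ p :: A ++ [:: v2; v3; v4; v5; v6; v7] ++ s).
    apply: perm_uniq; apply/permP=> Q; move: (permP pe Q).
    by rewrite /= !count_cat /=; count_arith.
  rewrite cat_uniq us uw andbT andTb; apply/hasPn=> w; apply: contraL.
  by rewrite /= !inE -!in_cons => /or3P[] /eqP ->; apply: Wd.
(* Either these five vertices already form a tent, or one of the two triples is heavy. Each use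
   below therefore adds one clause. *)
have good a1 a2 a3 a4 a5 o u' : u' \in [:: v5; v6; v7] ->
    perm_eq [:: a1; a2; a3; a4; a5; o; u'] [:: u; v2; v3; v4; v5; v6; v7] ->
    (exists d o u', [/\ tent c W d, u' \in [:: v5; v6; v7] &
      perm_eq (tent_seq d ++ [:: o; u']) [:: u; v2; v3; v4; v5; v6; v7]]) \/
    heavy a1 a2 a3 || heavy a3 a4 a5.
  move=> u'v pe; have [|] := boolP (heavy a1 a2 a3 || heavy a3 a4 a5); first by right.
  rewrite negb_or /heavy -!leqNgt => lt; left.
  by exists (a1, a2, a3, a4, a5), o, u'; split.
have i5 : v5 \in [:: v5; v6; v7] by rewrite !inE eqxx.
have i6 : v6 \in [:: v5; v6; v7] by rewrite !inE eqxx orbT.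
have i7 : v7 \in [:: v5; v6; v7] by rewrite !inE eqxx !orbT.
(* These fourteen instances of [good] and [nopath] are an unsatisfiable core, found
   by computer search. *)
have [//|g1] := good u v5 v4 v3 v7 v2 v6 i6 ltac:(perm_arith).
have [//|g2] := good v2 v4 v3 v5 v7 u v6 i6 ltac:(perm_arith).
have [//|g3] := good v2 v5 v4 v3 v6 u v7 i7 ltac:(perm_arith).
have [//|g4] := good v2 v6 u v4 v5 v3 v7 i7 ltac:(perm_arith).
have [//|g5] := good u v6 v2 v3 v7 v4 v5 i5 ltac:(perm_arith).
have [//|g6] := good u v6 v4 v2 v3 v7 v5 i5 ltac:(perm_arith).
have [//|g7] := good v2 v6 v7 v3 v4 u v5 i5 ltac:(perm_arith).
have [//|g8] := good u v2 v6 v3 v4 v5 v7 i7 ltac:(perm_arith).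
have [//|g9] := good v2 v4 v5 v3 v7 u v6 i6 ltac:(perm_arith).
have n1 := nopath v6 v4 v2 v5 v3 ltac:(perm_arith).
have n2 := nopath v5 v4 v6 v3 v2 ltac:(perm_arith).
have n3 := nopath v5 v4 v3 v2 v6 ltac:(perm_arith).
have n4 := nopath v2 v6 v4 v3 v5 ltac:(perm_arith).
have n5 := nopath v6 v2 v5 v4 v3 ltac:(perm_arith).
move: g1 g2 g3 g4 g5 g6 g7 g8 g9 n1 n2 n3 n4 n5.
(* Only ten unordered triples occur in the fourteen clauses; all their truth values are tried. *)
canon heavyC u v4 v5; canon heavyC v3 v4 v7; canon heavyC v2 v3 v4.
canon heavyC v3 v5 v7; canon heavyC v2 v4 v5; canon heavyC v3 v4 v6.
canon heavyC u v2 v6; canon heavyC v2 v3 v7; canon heavyC u v4 v6.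
canon heavyC v2 v6 v7.
by do 10?case: (heavy _ _ _).
Qed.

Definition tents_seq {T : finType} (D : seq (T * T * T * T * T)) :=
  flatten (map tent_seq D).

(** Induction, two edges at a time. The tents stay in [p :: A] and avoid the last vertex of [A'],
    which serves as [u] for the next window. Each step extends the original prefix [A] and reorders
    only its new last edge, so reorderings do not accumulate. *)
Lemma tents_along {T : finType} (c : {set T} -> bool) (W : {set T}) (p : T)
    (S : seq T) (l k : nat) :
  lpath c p S -> uniq (p :: S) -> size S = 3 * l ->
  {in W, forall w, w \notin p :: S} -> ~~ has_lpath c l.+1 -> 2 * k <= l ->
  exists D A A' s, [/\ S = A ++ s, size A = 6 * k, lpath c p A' & perm_eq A' A] /\
    [/\ size D = k, all (tent c W) D, uniq (last p A' :: tents_seq D) &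
        {subset tents_seq D <= p :: A}].
Proof.
move=> pS uS sS Wd nolong.
elim: k => [|k IHk] kl; first by exists [::], [::], [::], S.
have [|D [A [A' [s [[ES sA pA' peA] [sD tD uD subD]]]]]] := IHk; first by lia.
have: 6 <= size s by move: sS kl sA; rewrite ES size_cat; clear; lia.
case: s ES => [|v2 [|v3 [|v4 [|v5 [|v6 [|v7 s]]]]]] // ES _.
rewrite ES in pS uS sS Wd.
have pA : lpath c p A by apply: (lpath_catl _ _ _ _ (2 * k)) pS; move: sA; clear; lia.
move: (pS); rewrite lpath_cat //= => /and3P[c1 c2 ps].
have peS : perm_eq (p :: A' ++ [:: v2; v3; v4; v5; v6; v7] ++ s)
    (p :: A ++ [:: v2; v3; v4; v5; v6; v7] ++ s).
  by rewrite perm_cons perm_cat2r.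
have [|||d [o [u' [td u'v ped]]]] :=
    window c W p (last p A') A' s v2 v3 v4 v5 v6 v7 pA' erefl ps.
- by rewrite (perm_uniq peS).
- by move=> w /Wd; rewrite (perm_mem peS).
- rewrite (_ : _ + 3 = l.+1) //.
  by move: sS kl sA; rewrite (perm_size peA) size_cat /=; clear; lia.
(* The last edge is rewritten as [v4, x, y, u']: same edge, now ending in [u']. *)
have [x [y pe3]] : exists x y, perm_eq [:: x; y; u'] [:: v5; v6; v7].
  move: u'v; rewrite !inE => /or3P[] /eqP ->.
  - by exists v6, v7; perm_arith.
  - by exists v5, v7; perm_arith.
  - by exists v5, v6; perm_arith.
exists (d :: D), (A ++ [:: v2; v3; v4; v5; v6; v7]), (A ++ [:: v2; v3; v4; x; y; u']), s.
have lA : last p (A ++ [:: v2; v3; v4; x; y; u']) = u' by rewrite last_cat.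
split; split; rewrite ?lA.
- by rewrite -catA.
- by move: sA; rewrite size_cat /=; clear; lia.
- rewrite lpath_cat //= c1 (_ : [set v4; x; y; u'] = [set v4; v5; v6; v7]) ?c2 //.
  by apply: perm_set4; rewrite perm_cons.
- by rewrite perm_cat2l !perm_cons.
- by rewrite /= sD.
- by rewrite /= td.
- suff: uniq (o :: u' :: tent_seq d ++ tents_seq D) by case/andP.
  rewrite (perm_uniq (_ : perm_eq _ ([:: last p A'; v2; v3; v4; v5; v6; v7] ++ tents_seq D))).
    have: uniq (((p :: A) ++ [:: v2; v3; v4; v5; v6; v7]) ++ s) by rewrite -catA.
    rewrite cat_uniq => /andP[]; rewrite cat_uniq => /and3P[uA nA uv] _.
    have memu : last p A' \in p :: A.
      by have := mem_last p A'; rewrite !inE (perm_mem peA).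
    rewrite (perm_uniq (_ : perm_eq _ ((last p A' :: tents_seq D) ++ [:: v2; v3; v4; v5; v6; v7]))).
      rewrite cat_uniq uD uv andbT andTb; apply: contra nA => /hasP[v vv vD].
      apply/hasP; exists v => //; move: vD; rewrite /= inE => /orP[/eqP ->|/subD] //.
    by apply/permP=> Q; rewrite /= ?count_cat /=; count_arith.
  move: ped => /permP ped; apply/permP=> Q; move: (ped Q).
  by rewrite /= !count_cat /=; count_arith.
- move=> v; rewrite /tents_seq /= mem_cat => /orP[vd|/subD vA]; last first.
    by rewrite -cat_cons mem_cat vA.
  have : v \in [:: last p A'; v2; v3; v4; v5; v6; v7].
    by rewrite -(perm_mem ped) mem_cat vd.
  rewrite inE => /orP[/eqP ->|vv]; last by rewrite -cat_cons mem_cat vv orbT.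
  have := mem_last p A'; rewrite -cat_cons !mem_cat !inE (perm_mem peA).
  by move=> ->.
Qed.

Definition tent_system {T : finType} (c : {set T} -> bool) (W : {set T}) (z : T)
    (D : seq (T * T * T * T * T)) :=
  [/\ all (tent c W) D, uniq (z :: tents_seq D),
    {in W, forall w, w \notin z :: tents_seq D} &
    {in W & W & W, forall t1 t2 t3, uniq [:: t1; t2; t3] ->
      opp c [set z; t1; t2; t3]}].

Lemma tents_and_end {T : finType} (c : {set T} -> bool) (W : {set T}) (p : T)
    (S : seq T) (l k : nat) :
  lpath c p S -> uniq (p :: S) -> size S = 3 * l ->
  {in W, forall w, w \notin p :: S} -> ~~ has_lpath c l.+1 -> 2 * k <= l ->
  exists D z, size D = k /\ tent_system c W z D.
Proof.
move=> pS uS sS Wd nolong kl.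
have [D [A [A' [s [[ES sA pA' peA] [sD tD uD subD]]]]]] :=
  tents_along c W p S l k pS uS sS Wd nolong kl.
suff [z [B [pB sB uB]]] : exists z B, [/\ lpath c p B /\ last p B = z,
    perm_eq B S & uniq (z :: tents_seq D)].
  exists D, z; split=> //; split=> //.
    move=> w wW; have := Wd w wW; apply: contra; rewrite inE => /orP[/eqP ->|/subD].
      by case: pB => _ <-; have := mem_last p B; rewrite !inE (perm_mem sB).
    by rewrite ES -cat_cons mem_cat => ->.
  move=> t1 t2 t3 W1 W2 W3 ut; apply: contra nolong => ct.
  apply/has_lpathP; exists p, (B ++ [:: t1; t2; t3]); case: pB => pB lB.
  split; first by rewrite lpath_cat //= lB ct.
    have peB : perm_eq (p :: B) (p :: S) by rewrite perm_cons.
    rewrite -cat_cons cat_uniq (perm_uniq peB) uS ut andbT andTb.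
    apply/hasPn=> v vt; rewrite (perm_mem peB).
    by move: vt; rewrite 3!in_cons in_nil orbF => /or3P[] /eqP ->; apply: Wd.
  by rewrite size_cat (perm_size sB) sS /=; clear; lia.
(* If the tents consume all of [S], the end [z] is the leftover vertex of the reordered path;
   otherwise the last vertex of [S] lies beyond all tents. *)
case: (lastP s) ES => [|s' z] ES.
  by exists (last p A'), A'; split=> //; rewrite ES cats0.
exists z, S; rewrite pS ES last_cat last_rcons; split=> //.
move: uD; rewrite !cons_uniq => /andP[_ uD]; rewrite uD andbT; apply/negP=> /subD zA.
move: uS; rewrite ES -cat_cons cat_uniq => /and3P[_ /hasP nA _].
by apply: nA; exists z; rewrite ?mem_rcons ?inE ?eqxx.
Qed.

(** * Blue paths zigzagging between the tents and [W] *)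

Lemma opp_edge {T : finType} (c : {set T} -> bool) (W : {set T}) (w a b d : T) :
  w \in W -> w \notin red_nbrs c W a b d -> opp c [set w; a; b; d].
Proof. by rewrite inE => ->. Qed.

(* The first attachment vertex, in front of [a1], is left to be chosen last: this
   order is what makes [size D + 4] vertices enough. *)
Lemma zigzag_from {T : finType} (c : {set T} -> bool) (W V : {set T})
    (a1 a2 a3 a4 a5 : T) (D : seq (T * T * T * T * T)) :
  V \subset W -> size D + 4 <= #|V| ->
  all (tent c W) ((a1, a2, a3, a4, a5) :: D) ->
  exists xs q, [/\ uniq xs, {subset xs <= V}, size xs = (size D).+1,
    perm_eq q ([:: a4; a5] ++ tents_seq D ++ xs) &
    lpath (opp c) a3 q /\ last a3 q \in xs].
Proof.
elim: D V a1 a2 a3 a4 a5 => [|[[[[b1 b2] b3] b4] b5] D IHD] V a1 a2 a3 a4 a5 VW sV.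
  case/andP=> /andP[_ X2] _.
  have [|x xV xX] := exists_notin V (red_nbrs c W a3 a4 a5).
    by rewrite /= in sV; lia.
  exists [:: x], [:: a4; a5; x]; split=> //; first by move=> y; rewrite inE => /eqP ->.
  rewrite /= inE eqxx andbT (_ : [set a3; a4; a5; x] = [set x; a3; a4; a5]); last same_set4.
  by rewrite (opp_edge c W) // (subsetP VW).
case/andP=> /andP[_ X2] tD; have /andP[/andP[Y2 _] _] := tD.
(* The vertex joining two tents must avoid two exceptions of each, four in total. *)
have [|x xV] := exists_notin V (red_nbrs c W a3 a4 a5 :|: red_nbrs c W b1 b2 b3).
  by rewrite /= in sV; rewrite cardsU; lia.
rewrite inE negb_or => /andP[xX xY].
have [||xs [q [uxs sub sxs peq [pq lq]]]] := IHD (V :\ x) b1 b2 b3 b4 b5 _ _ tD.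
- by apply: subset_trans VW; apply: subsetDl.
- by rewrite cards_rem1 //; move: sV => /=; lia.
have xW : x \in W by apply: (subsetP VW).
exists (x :: xs), ([:: a4; a5; x; b1; b2; b3] ++ q); split.
- by rewrite /= uxs andbT; apply/negP => /sub; rewrite !inE eqxx.
- by move=> y; rewrite inE => /orP[/eqP -> //|/sub]; rewrite inE => /andP[].
- by rewrite /= sxs.
- apply/permP=> Q; move: (permP peq Q).
  by rewrite /tents_seq /= ?count_cat /= ?count_cat /=; count_arith.
split; last by rewrite last_cat inE lq orbT.
rewrite /= pq (_ : [set a3; a4; a5; x] = [set x; a3; a4; a5]); last same_set4.
by rewrite !(opp_edge c W).
Qed.

Lemma uniq_tents_cat {T : finType} (W : {set T}) (s xs : seq T) :
  uniq s -> {in W, forall w, w \notin s} -> uniq xs -> {subset xs <= W} ->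
  uniq (s ++ xs).
Proof.
move=> us Ws uxs sub; rewrite cat_uniq us uxs andbT /=.
by apply/hasPn=> x /sub; apply: Ws.
Qed.

Lemma card_minus_seq {T : finType} (V : {set T}) (xs : seq T) :
  #|V| - size xs <= #|V :\: [set x in xs]|.
Proof.
have := cardsID [set x in xs] V.
have : #|V :&: [set x in xs]| <= size xs.
  apply: leq_trans (card_size xs).
  by apply: subset_leq_card; apply/subsetP=> x; rewrite !inE => /andP[].
by move: (size xs); lia.
Qed.

(** The front vertex, chosen last, has only two exceptions besides the vertices already used. This
    brings the requirement down to three more vertices than there are tents. *)
Lemma zigzag {T : finType} (c : {set T} -> bool) (W : {set T})
    (D : seq (T * T * T * T * T)) :
  size D + 3 <= #|W| -> all (tent c W) D ->
  exists x s xs, [/\ uniq xs, {subset xs <= W}, size xs = (size D).+1,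
    perm_eq (x :: s) (tents_seq D ++ xs) & lpath (opp c) x s /\ last x s \in xs].
Proof.
case: D => [|[[[[a1 a2] a3] a4] a5] D] sW tD.
  have [|x xW _] := exists_notin W set0; first by rewrite cards0; lia.
  exists x, [::], [:: x]; rewrite /= inE eqxx; split=> //.
  by move=> y; rewrite inE => /eqP ->.
have {}sW : size D + 4 <= #|W| by move: sW => /=; lia.
have [xs [q [uxs sub sxs peq [pq lq]]]] :=
  zigzag_from c W W a1 a2 a3 a4 a5 D (subxx _) sW tD.
have /andP[/andP[X2 _] _] := tD.
have [|x xV xX] := exists_notin (W :\: [set x in xs]) (red_nbrs c W a1 a2 a3).
  by have := card_minus_seq W xs; rewrite sxs; move: sW X2; clear; lia.
move: xV; rewrite !inE => /andP[xxs xW].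
exists x, ([:: a1; a2; a3] ++ q), (x :: xs); split.
- by rewrite /= xxs.
- by move=> y; rewrite inE => /orP[/eqP -> //|/sub].
- by rewrite /= sxs.
- apply/permP=> Q; move: (permP peq Q).
  by rewrite /tents_seq /= ?count_cat /= ?count_cat /=; count_arith.
split; last by rewrite last_cat inE lq orbT.
by rewrite /= pq (opp_edge c W).
Qed.

(** * Lengthening the zigzag through the end [z] *)

Lemma size_tents_seq {T : finType} (D : seq (T * T * T * T * T)) :
  size (tents_seq D) = 5 * size D.
Proof.
rewrite /tents_seq; elim: D => [|[[[[a1 a2] a3] a4] a5] D IHD] //=.
by rewrite IHD; lia.
Qed.

Lemma pick_list {T : finType} (V : {set T}) (n : nat) :
  n <= #|V| -> exists ts, [/\ uniq ts, size ts = n & {subset ts <= V}].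
Proof.
move=> nV; exists (take n (enum V)); split.
- by rewrite take_uniq // enum_uniq.
- by rewrite size_takel // -cardE.
- by move=> x /mem_take; rewrite mem_enum.
Qed.

(** The zigzag uses [size D + 1] vertices of [W]. Two further ones join its end to [z] by a blue
    edge; if [e] holds, three more give a second blue edge leaving [z]. *)
Lemma opp_path_odd_even {T : finType} (c : {set T} -> bool) (W : {set T}) (z : T)
    (D : seq (T * T * T * T * T)) (e : bool) :
  tent_system c W z D ->
  size D + (if e then 6 else 3) <= #|W| ->
  has_lpath (opp c) (2 * size D + 1 + e).
Proof.
move=> [tD uD WD zW] sW; have [|//|x [s [xs [uxs sub sxs pes [ps ls]]]]] := zigzag c W D.
  by case: e sW; lia.
have [|ts [uts sts subts]] :=
    pick_list (W :\: [set x in xs]) (if e then 5 else 2).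
  by have := card_minus_seq W xs; rewrite sxs; case: e sW; clear; lia.
have tsW t : t \in ts -> t \in W by move/subts; rewrite inE => /andP[].
have tsx t : t \in ts -> t \notin xs by move/subts; rewrite !inE => /andP[].
have uall : uniq (xs ++ ts).
  rewrite cat_uniq uxs uts andbT /=; apply/hasPn=> t; exact: tsx.
have subW : {subset xs ++ ts <= W}.
  by move=> t; rewrite mem_cat => /orP[/sub|/tsW].
have uz := uniq_tents_cat W _ _ uD WD uall subW.
have lW : last x s \in W := sub _ ls.
have ss : size s = 6 * size D.
  by have := perm_size pes; rewrite /= size_cat size_tents_seq sxs; clear; lia.
case: ts sts uts tsW tsx {subts uall subW} uz => [|t1 [|t2 ts]]; try by case: (e).
move=> sts uts tsW tsx uz.
have W1 : t1 \in W by apply: tsW; rewrite !inE eqxx.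
have W2 : t2 \in W by apply: tsW; rewrite !inE eqxx orbT.
have ult : uniq [:: last x s; t1; t2].
  case/and3P: uts; rewrite inE negb_or => /andP[n12 _] _ _.
  rewrite /= !inE negb_or n12 !andbT.
  by apply/andP; split; apply: contraTneq ls => ->; apply: tsx; rewrite !inE eqxx ?orbT.
have c1 : opp c [set last x s; t1; t2; z].
  rewrite (_ : [set _; _; _; _] = [set z; last x s; t1; t2]) ?zW //; same_set4.
apply/has_lpathP; exists x, (s ++ [:: t1; t2; z] ++ ts); split.
- rewrite lpath_cat //= c1 /=.
  case: (e) sts tsW uts => [|] sts tsW uts; last by case: (ts) sts.
  case: (ts) sts tsW uts => [|t3 [|t4 [|t5 [|//]]]] // _ tsW uts.
  rewrite /= andbT zW ?tsW // ?inE ?eqxx ?orbT //.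
  by case/and3P: uts.
- rewrite -cat_cons (perm_uniq (_ : perm_eq _ ((z :: tents_seq D) ++ xs ++ t1 :: t2 :: ts))) //.
  apply/permP=> Q; move: (permP pes Q).
  by rewrite /= ?count_cat /= ?count_cat /=; count_arith.
- by rewrite size_cat ss /=; move: sts; clear; case: (e) => /=; lia.
Qed.

Lemma perm_uniq_imp {T : eqType} (s1 s2 : seq T) :
  perm_eq s1 s2 -> uniq s2 -> uniq s1.
Proof. by move/perm_uniq ->. Qed.

Lemma uniq_catr {T : eqType} (s1 s2 : seq T) : uniq (s1 ++ s2) -> uniq s2.
Proof. by rewrite cat_uniq => /and3P[]. Qed.

Lemma uniq3 {T : eqType} (a b d : T) :
  uniq [:: a; b; d] = [&& a != b, a != d & b != d].
Proof. by rewrite /= !inE negb_or andbT andbA. Qed.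

Lemma notin_small {T : finType} (X : {set T}) (t1 t2 y : T) :
  #|X| <= 2 -> t1 \in X -> t2 \in X -> uniq [:: t1; t2; y] -> y \notin X.
Proof.
move=> sX X1 X2 ut; apply: contraL sX => yX; rewrite -ltnNge.
rewrite -[2.+1]/(size [:: t1; t2; y]) -(card_uniqP ut); apply: subset_leq_card.
by apply/subsetP=> v; rewrite !inE => /or3P[] /eqP ->.
Qed.

(** With k tents, a zigzag through all of them has 2k edges but is only guaranteed when [W] has k +
    3 vertices. Here k + 2 suffice, because an edge through [z] replaces one edge of a tent. *)
Lemma opp_path_tight {T : finType} (c : {set T} -> bool) (W : {set T}) (z : T)
    (d' d : T * T * T * T * T) (D : seq (T * T * T * T * T)) :
  tent_system c W z (d' :: d :: D) -> size D + 4 <= #|W| ->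
  has_lpath (opp c) (2 * (size D).+2).
Proof.
case: d d' => [[[[a1 a2] a3] a4] a5] [[[[e1 e2] e3] e4] e5] [tD uD WD zW] sW.
have /andP[/andP[Y1 Y2] td] := tD; have /andP[/andP[X1 X2] _] := td.
have [xs [q [uxs sub sxs peq [pq lq]]]] :=
  zigzag_from c W W a1 a2 a3 a4 a5 D (subxx _) sW td.
have [|x xV xX] := exists_notin (W :\: [set x in xs]) (red_nbrs c W a1 a2 a3).
  by have := card_minus_seq W xs; rewrite sxs; move: sW X1; clear; lia.
move: xV; rewrite !inE => /andP[xxs xW].
have [|ts [uts sts subts]] := pick_list (W :\: [set v in x :: xs]) 2.
  by have := card_minus_seq W (x :: xs); rewrite /= sxs; move: sW; clear; lia.
case: ts sts uts subts => [|t1 [|t2 [|//]]] // _ uts subts.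
have tsW t : t \in [:: t1; t2] -> t \in W by move/subts; rewrite inE => /andP[].
have tsx t : t \in [:: t1; t2] -> t \notin x :: xs.
  by move/subts; rewrite inE => /andP[]; rewrite inE.
have uall : uniq ((x :: xs) ++ [:: t1; t2]).
  have uxxs : uniq (x :: xs) by rewrite /= xxs.
  by rewrite cat_uniq uxxs uts andbT; apply/hasPn=> t; apply: tsx.
have subW : {subset (x :: xs) ++ [:: t1; t2] <= W}.
  move=> t; rewrite mem_cat => /orP[|/tsW //].
  by rewrite inE => /orP[/eqP -> //|/sub].
have uz := uniq_tents_cat W _ _ uD WD uall subW.
have sq : size q = 6 * size D + 3.
  by rewrite (perm_size peq) !size_cat size_tents_seq sxs /=; clear; lia.
set y := last a3 q in lq; have yW : y \in W := sub _ lq.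
have neq v t : v \in x :: xs -> t \in [:: t1; t2] -> v != t.
  by move=> vx /tsx; apply: contra => /eqP <-.
have yx : y \in x :: xs by rewrite inE lq orbT.
have xx : x \in x :: xs by rewrite inE eqxx.
have i1 : t1 \in [:: t1; t2] by rewrite inE eqxx.
have i2 : t2 \in [:: t1; t2] by rewrite !inE eqxx orbT.
have n12 : t1 != t2 by move: uts; rewrite /= inE andbT.
(* The zigzag leaves t1, t2 in [W] unused.  If one of them attaches to [d'],
   continue x, ..., y, {t', z}, t, d'.  Otherwise t1, t2 are the two exceptions of
   both edges of [d'], so start inside [d] instead: ..., y, d', x, {t1, t2, z}. *)
have branch t t' f1 f2 f3 f4 f5 :
    perm_eq [:: t; t'] [:: t1; t2] ->
    perm_eq [:: f1; f2; f3; f4; f5] [:: e1; e2; e3; e4; e5] ->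
    t \notin red_nbrs c W f1 f2 f3 -> has_lpath (opp c) (2 * (size D).+2).
  move=> pt pf tX.
  have it : t \in [:: t1; t2] by rewrite -(perm_mem pt) !inE eqxx.
  have it' : t' \in [:: t1; t2] by rewrite -(perm_mem pt) !inE eqxx orbT.
  have utt : t' != t by move: (perm_uniq pt); rewrite uts /= inE andbT eq_sym.
  apply/has_lpathP; exists x, ([:: a1; a2; a3] ++ q ++ [:: t'; z; t; f1; f2; f3]).
  split; last by rewrite !size_cat sq /=; clear; lia.
    rewrite /= lpath_cat // -/y /= (opp_edge c W x) // (opp_edge c W t) ?tsW //= andbT.
    rewrite (_ : [set _; _; _; _] = [set z; y; t'; t]); last same_set4.
    by apply: zW; rewrite ?(tsW t) ?(tsW t') // uniq3 utt !neq.
  apply: (uniq_catr [:: f4; f5]).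
  apply: perm_uniq_imp uz.
  apply/permP=> Q; move: (permP peq Q) (permP pf Q) (permP pt Q).
  by rewrite /tents_seq /= ?count_cat /= ?count_cat /=; count_arith.
have [t1X|] := boolP (t1 \in red_nbrs c W e1 e2 e3); last first.
  by apply: (branch t1 t2 e1 e2 e3 e4 e5); perm_arith.
have [t2X|] := boolP (t2 \in red_nbrs c W e1 e2 e3); last first.
  by apply: (branch t2 t1 e1 e2 e3 e4 e5); perm_arith.
have [t1Y|] := boolP (t1 \in red_nbrs c W e3 e4 e5); last first.
  by apply: (branch t1 t2 e3 e4 e5 e1 e2); perm_arith.
have [t2Y|] := boolP (t2 \in red_nbrs c W e3 e4 e5); last first.
  by apply: (branch t2 t1 e3 e4 e5 e1 e2); perm_arith.
have u3 v : v \in x :: xs -> uniq [:: t1; t2; v].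
  by move=> vx; rewrite uniq3 n12 ![_ == v]eq_sym !neq.
have yE := notin_small _ _ _ _ Y1 t1X t2X (u3 y yx).
have xE := notin_small _ _ _ _ Y2 t1Y t2Y (u3 x xx).
apply/has_lpathP.
exists a3, (q ++ [:: e1; e2; e3; e4; e5; x; t1; t2; z]); split.
- rewrite lpath_cat // -/y /= (opp_edge c W y) //.
  rewrite (_ : [set e3; e4; e5; x] = [set x; e3; e4; e5]); last same_set4.
  rewrite (opp_edge c W x) //= (_ : [set _; _; _; _] = [set z; x; t1; t2]); last same_set4.
  by rewrite andbT; apply: zW; rewrite ?(tsW t1) ?(tsW t2) // uniq3 n12 !neq.
- apply: (uniq_catr [:: a1; a2]).
  apply: perm_uniq_imp uz.
  apply/permP=> Q; move: (permP peq Q).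
  by rewrite /tents_seq /= ?count_cat /= ?count_cat /=; count_arith.
- by rewrite size_cat sq /=; clear; lia.
Qed.

(** * The upper bound: comparing longest red and blue paths *)

(** Off the longest path there are [#|T| - 3 * l - 1] vertices. The three thresholds say that [W]
    has at least k + 3, k + 6 and k + 2 of them; each tent costs two edges, hence [2 * k <= l]. *)
Lemma opp_of_longest {T : finType} (c : {set T} -> bool) (l k : nat) :
  has_lpath c l -> ~~ has_lpath c l.+1 -> 2 * k <= l ->
  [/\ 3 * l + k + 4 <= #|T| -> has_lpath (opp c) (2 * k + 1),
      3 * l + k + 7 <= #|T| -> has_lpath (opp c) (2 * k + 2) &
      2 <= k -> 3 * l + k + 3 <= #|T| -> has_lpath (opp c) (2 * k)].
Proof.
case/has_lpathP=> p [S [pS uS sS]] nolong kl.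
pose W := ~: [set v in p :: S].
have cW : #|W| = #|T| - (3 * l).+1.
  by rewrite cardsCs setCK cardsE (card_uniqP uS) /= sS.
have Wd : {in W, forall w, w \notin p :: S} by move=> w; rewrite !inE.
have [D [z [sD tz]]] := tents_and_end c W p S l k pS uS sS Wd nolong kl.
split=> [sT|sT|k2 sT].
- have := opp_path_odd_even c W z D false tz; rewrite sD addn0; apply.
  by rewrite cW; move: sT; clear; lia.
- have := opp_path_odd_even c W z D true tz; rewrite sD -addnA; apply.
  by rewrite cW; move: sT; clear; lia.
case: D sD tz => [|d' [|d D]] /=; try by move=> sD; move: k2; rewrite -sD.
move=> sD tz; rewrite -sD; apply: opp_path_tight tz _.
by rewrite cW; move: sT sD; clear; lia.
Qed.

Lemma lpath_dichotomy {T : finType} (c : {set T} -> bool) (n m : nat) :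
  3 <= m -> m <= n -> (5 <= m + 2 <= n \/ odd n) ->
  #|T| = 3 * n + (m + 1)./2 ->
  has_lpath c n || has_lpath (opp c) m.
Proof.
move=> m3 mn nm cT; apply/negPn/negP; rewrite negb_or => /andP[nr nb].
have T0 : 0 < #|T| by rewrite cT; move: m3 mn; clear; lia.
have [l [ln hl nl]] := max_lpath c n T0 nr.
have [l' [lm hl' nl']] := max_lpath (opp c) m T0 nb.
have short k : has_lpath (opp c) k -> k < m.
  by move=> hk; rewrite ltnNge; apply: contra nb => /has_lpath_widen; apply.
have longest k : has_lpath (opp c) k -> k <= l'.
  by move=> hk; rewrite leqNgt; apply: contra nl' => /has_lpath_widen; apply.
have [kl' kl] : 2 * (l' %/ 2) <= l' /\ 2 * (l %/ 2) <= l by clear; lia.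
have [long _ _] := opp_of_longest (opp c) l' (l' %/ 2) hl' nl' kl'.
(* Otherwise the longest blue path would yield a red one with [2 * (l' %/ 2) + 1 >= l'] edges, more
   than [l]. *)
have l'l : l' <= l.
  rewrite leqNgt; apply/negP => ll'.
  have /long : 3 * l' + l' %/ 2 + 4 <= #|T|.
    by rewrite cT; move: lm mn; clear; lia.
  have cc : opp (opp c) =1 c by move=> e; rewrite /opp negbK.
  rewrite (eq_has_lpath _ _ _ cc) => /(has_lpath_widen c l.+1) h.
  by case/negP: nl; apply: h; move: ll'; clear; lia.
(* If [l] is large, m/2 tents (rounded down) already give a blue path with [m] edges. If [l] is
   small, [W] has room for two edges at [z], giving [2 * (l %/ 2) + 2 > l >= l'] blue edges. *)
have [oddm|evenm] := boolP (odd m).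
  have [lsmall|lbig] := ltnP l m.-1; last first.
    have kl2 : 2 * (m %/ 2) <= l by move: lbig oddm; clear; lia.
    have [h _ _] := opp_of_longest c l (m %/ 2) hl nl kl2.
    have /h/short : 3 * l + m %/ 2 + 4 <= #|T|.
      by rewrite cT; move: ln oddm; clear; lia.
    by move: oddm; clear; lia.
  have [_ h _] := opp_of_longest c l (l %/ 2) hl nl kl.
  have /h/longest : 3 * l + l %/ 2 + 7 <= #|T|.
    by rewrite cT; move: lsmall mn m3; clear; lia.
  by move: l'l; clear; lia.
have [lbig|lsmall] := leqP m l.
  have kl2 : 2 * (m %/ 2) <= l by move: lbig; clear; lia.
  have [_ _ h] := opp_of_longest c l (m %/ 2) hl nl kl2.
  have m2 : 2 <= m %/ 2 by move: m3 evenm; clear; lia.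
  have /(h m2)/short : 3 * l + m %/ 2 + 3 <= #|T|.
    by rewrite cT; move: ln evenm; clear; lia.
  by move: evenm; clear; lia.
have [_ h _] := opp_of_longest c l (l %/ 2) hl nl kl.
(* The assumption on [n] enters here: for even [m] it excludes n = m, so that [l <= n - 2]. *)
have /h/longest : 3 * l + l %/ 2 + 7 <= #|T|.
  by rewrite cT; move: nm lsmall mn m3 evenm; clear; lia.
by move: l'l; clear; lia.
Qed.

Lemma ramsey_arrows_upper (n m : nat) :
  3 <= m -> m <= n -> (5 <= m + 2 <= n \/ odd n) ->
  ramsey_arrows n m (3 * n + (m + 1)./2).
Proof.
move=> m3 mn nm c.
have := lpath_dichotomy c n m m3 mn nm; rewrite card_ord => /(_ erefl).
by case/orP=> /has_loose_of_lpath h; [left | right].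
Qed.

(** * The lower bound *)

Lemma ramsey_arrows_lower (n m N : nat) :
  0 < n -> 0 < m -> ramsey_arrows n m N -> 3 * n + (m + 1)./2 <= N.
Proof.
move=> n0 m0 /(_ (fun e => [forall v in e, v < 3 * n])) [] [f [f_inj col]].
  have lt j : f j < 3 * n.
    have [i [k Ej]] : exists (i : 'I_n) (k : 'I_4), j = inord (3 * i + k).
      (* The cap [n.-1] puts the final vertex 3n into the last edge, at offset 3. *)
      have lti : minn (j %/ 3) n.-1 < n by move: n0; clear; lia.
      have ltk : j - 3 * minn (j %/ 3) n.-1 < 4.
        by have := ltn_ord j; move: n0; clear; lia.
      exists (Ordinal lti), (Ordinal ltk); apply: val_inj.
      by rewrite /= subnKC ?inord_val //; clear; lia.
    by have /forall_inP := col i; rewrite Ej; apply; apply: imset_f.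
  have : injective (fun j => Ordinal (lt j)) by move=> i j [] /val_inj /f_inj.
  by move/leq_card; rewrite !card_ord; clear; lia.
have big (i : 'I_m) : exists k : 'I_4, 3 * n <= f (inord (3 * i + k)).
  have := col i; rewrite negb_forall => /existsP[v]; rewrite negb_imply -leqNgt.
  by case/andP=> /imsetP[k _ ->] nk; exists k.
pose k i := xchoose (big i).
(* Edges of even index are pairwise disjoint, so their vertices outside the red set are distinct. *)
have lt2 (j : 'I_(m + 1)./2) : 2 * j < m by have := ltn_ord j; clear; lia.
pose pos (j : 'I_(m + 1)./2) : 'I_(3 * m).+1 := inord (3 * (2 * j) + k (Ordinal (lt2 j))).
have posE j : pos j = 3 * (2 * j) + k (Ordinal (lt2 j)) :> nat.
  rewrite inordK //; have := lt2 j; have := ltn_ord (k (Ordinal (lt2 j))).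
  by clear; lia.
have lt j : f (pos j) - 3 * n < N - 3 * n.
  have := xchooseP (big (Ordinal (lt2 j))); have := ltn_ord (f (pos j)).
  by rewrite /pos /k /=; clear; lia.
have : injective (fun j => Ordinal (lt j)).
  move=> i j [] E; apply: val_inj.
  have : pos i = pos j.
    apply: f_inj; apply: val_inj; move: E.
    have := xchooseP (big (Ordinal (lt2 i))).
    have := xchooseP (big (Ordinal (lt2 j))).
    by rewrite /pos /k /=; clear; lia.
  move/(congr1 val); rewrite /= !posE.
  have := ltn_ord (k (Ordinal (lt2 i))); have := ltn_ord (k (Ordinal (lt2 j))).
  by clear; lia.
move/leq_card; rewrite !card_ord => hN.
(* Positivity of [m] matters: it excludes that [N - 3 * n] was truncated to 0. *)
by move: hN m0; clear; lia.
Qed.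

Theorem theorem3p6 (n m : nat) :
  3 <= m -> m <= n -> (5 <= m + 2 <= n \/ odd n) ->
  ramsey_number_is n m (3 * n + (m + 1)./2).
Proof.
move=> m3 mn nm; split; first exact: ramsey_arrows_upper.
by move=> N; apply: ramsey_arrows_lower; lia.
Qed.
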